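(* Let $(\Omega,\mathcal F,(\mathcal F_A)_{A\in\mathcal A},\mathbb P)$ be a complete probability space with a set-indexed filtration, and let $X=\{X_A;A\in\mathcal A\}$ be an $E$-valued $\mathcal C$-Markov process with respect to $(\mathcal F_A)_{A\in\mathcal A}$. Then the initial distribution $\nu$ of $X$ (i.e. the law of $X_{\emptyset'}$) and the $\mathcal C$-transition system $\mathcal P=\{P_C(\mathbf x_C;\mathrm dx_A);\,C\in\mathcal C\}$ of $X$ characterize entirely the law of $X$; that is, the finite-dimensional distributions of $X$ are determined by $\nu$ and $\mathcal P$, so that any two $\mathcal C$-Markov processes with the same initial distribution and the same $\mathcal C$-transition system have the same finite-dimensional distributions.
   Context: Indexing collection. $\mathcal T$ is a locally compact metric space and $(E,d_E)$ is a locally compact separable metric space with Borel $\sigma$-field $\mathcal E$. The indexing collection $\mathcal A$ is a class of compact subsets of $\mathcal T$ such that: (i) $\mathcal A$ is closed under arbitrary intersections and $A^\circ\neq A$ for all $A\in\mathcal A$, $A\neq\mathcal T$; (ii) $\emptyset':=\bigcap_{A\in\mathcal A}A$ is nonempty; (iii) there is an increasing sequence $(B_n)_{n\in\mathbf N}$ in $\mathcal A$ with $\mathcal T=\bigcup_nB_n$; (iv) (Shape) if $A,A_1,\dots,A_k\in\mathcal A$ and $A\subseteq\bigcup_{i=1}^kA_i$ then $A\subseteq A_i$ for some $i$. Increments. $\mathcal A(u)$ is the class of (nonempty) finite unions of sets of $\mathcal A$, and $\mathcal C$ is the class of increments $C=A\setminus B$, $A\in\mathcal A$, $B\in\mathcal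 A(u)$. To $C$ one associates $A$ and $B$ with $C=A\setminus B$, $B\subseteq A$, $B=\bigcup_{i=1}^kA_i$ being the extremal representation ($A_i\in\mathcal A$, $A_i\not\subseteq A_j$ for $i\ne j$). Let $\mathcal A_\ell$ be the set of all intersections of nonempty subfamilies of $\{A_1,\dots,A_k\}$, and $\mathcal A_C=\{U\in\mathcal A_\ell;\ U\not\subseteq B^\circ\}=\{U_C^1,\dots,U_C^p\}$, $p=|\mathcal A_C|$. For a process $X$, $\mathbf X_C=(X_{U_C^1},\dots,X_{U_C^p})$; similarly $\mathbf x_C=(x_{U_C^1},\dots,x_{U_C^p})\in E^{|\mathcal A_C|}$. Filtrations. A filtration $(\mathcal F_A)_{A\in\mathcal A}$ is an increasing family of complete sub-$\sigma$-fields. For $B\in\mathcal A(u)$, $\mathcal F_B=\bigvee_{A\in\mathcal A,A\subseteq B}\mathcal F_A$, and for $C\in\mathcal C$, $\mathcal G^*_C=\bigvee_{B\in\mathcal A(u),\,B\cap C=\emptyset}\mathcal F_B$. $\mathcal C$-Markov property. An $E$-valued process $X=\{X_A;A\in\mathcal A\}$ is $\mathcal C$-Markov w.r.t. $(\mathcal F_A)$ if it is adapted and, for all $C=A\setminus B\in\mathcal C$ and all bounded measurable $f:E\to\mathbf R$, $\mathbb E[f(X_A)\mid\mathcal G^*_C]=\mathbb E[f(X_A)\mid\mathbf X_C]$ a.s. $\mathcal C$-transition system of $X$. It is the collection of transition probabilities $P_C(\mathbf x_C;\Gamma)=\mathbb P(X_A\in\Gamma\mid\mathbf X_C=\mathbf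 x_C)$, for $C=A\setminus B\in\mathcal C$, $\mathbf x_C\in E^{|\mathcal A_C|}$, $\Gamma\in\mathcal E$. *)

(* Defs.v *)
From HB Require Import structures.
From mathcomp Require Import all_boot all_order all_algebra finmap.
From mathcomp Require Import all_classical all_reals all_analysis.

Set Implicit Arguments.
Unset Strict Implicit.
Unset Printing Implicit Defensive.
Import Order.TTheory GRing.Theory Num.Theory.
Import numFieldNormedType.Exports.

Local Open Scope classical_set_scope.
Local Open Scope ring_scope.

#[short(type="pmetricType")]
HB.structure Definition PointedMetric (R : numDomainType) :=
  {M of Metric R M & isPointed M}.

Definition separable (E : topologicalType) : Prop :=
  exists2 S : set E, countable S & dense S.

Notation borel E := (g_sigma_algebraType (@open E)).

Section indexing_collection.
Context {T : topologicalType}.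
Implicit Types (cA : set (set T)).

(* The empty family is excluded from (i): its intersection would be the whole
   space, which need not be compact. *)
Record indexing_collection cA : Prop := {
  indexing_compact : forall A, cA A -> compact A ;
  indexing_bigcap : forall S : set (set T),
    S `<=` cA -> S !=set0 -> cA (\bigcap_(A in S) A) ;
  indexing_interior : forall A, cA A -> A <> setT -> A° <> A ;
  indexing_bigcap_neq0 : \bigcap_(A in cA) A !=set0 ;
  indexing_exhaustion : exists B : nat -> set T,
    [/\ forall n, cA (B n), forall n, B n `<=` B n.+1 &
        \bigcup_n B n = setT] ;
  indexing_shape : forall (A : set T) (k : nat) (A_ : 'I_k -> set T),
    cA A -> (forall i, cA (A_ i)) -> A `<=` \bigcup_i A_ i ->
    exists i, A `<=` A_ i }.

Definition initial_set cA : set T := \bigcap_(A in cA) A.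

Definition finite_unions cA : set (set T) :=
  [set B | exists S : set (set T),
    [/\ finite_set S, S !=set0, S `<=` cA & B = \bigcup_(A in S) A]].

(* An increment C = A \ B is stored as A (inc_top) together with the set
   {A_1, ..., A_k} of the extremal representation of B (inc_low). By (Shape),
   both are determined by the set A \ B because the latter is nonempty. *)
Record increment cA := Increment {
  inc_top : set T ;
  inc_low : set (set T) ;
  inc_topP : cA inc_top ;
  inc_low_finite : finite_set inc_low ;
  inc_low_neq0 : inc_low !=set0 ;
  inc_lowP : inc_low `<=` cA ;
  inc_low_extremal :
    forall U V, inc_low U -> inc_low V -> U `<=` V -> U = V ;
  inc_low_sub : \bigcup_(U in inc_low) U `<=` inc_top ;
  inc_neq0 : inc_top `\` \bigcup_(U in inc_low) U !=set0 }.

Section increment_faces.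
Context {cA : set (set T)} (C : increment cA).

Definition inc_union : set T := \bigcup_(U in inc_low C) U.

Definition inc_set : set T := inc_top C `\` inc_union.

Definition inc_meets : set (set T) :=
  [set U | exists S : set (set T),
    [/\ S `<=` inc_low C, S !=set0 & U = \bigcap_(V in S) V]].

Definition inc_faces : set (set T) :=
  [set U | inc_meets U /\ ~ (U `<=` inc_union°)].

(* A fixed enumeration U_C^1, ..., U_C^p of the finite set of faces. *)
Definition inc_enum : seq (set T) := fset_set inc_faces.

End increment_faces.

End indexing_collection.

Section set_indexed_processes.
Context {R : realType} {T : topologicalType} {E : pmetricType R}.
Context {d : measure_display} {Omega : measurableType d}.
Variables (P : probability Omega R) (cA : set (set T)).

(* Processes and filtrations are total functions on subsets of T; only their
   values on the indexing collection are relevant. *)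
Implicit Types (F : set T -> set (set Omega)) (X : set T -> Omega -> borel E).

Record filtration F : Prop := {
  filtration_sigma_algebra : forall A, cA A -> sigma_algebra setT (F A) ;
  filtration_measurable : forall A, cA A -> F A `<=` measurable ;
  filtration_complete : forall A, cA A -> P.-negligible `<=` F A ;
  filtration_increasing :
    forall A B, cA A -> cA B -> A `<=` B -> F A `<=` F B }.

Definition filtration_union F (B : set T) : set (set Omega) :=
  <<s \bigcup_(A in [set A | cA A /\ A `<=` B]) F A >>.

Definition strong_history F (C : set T) : set (set Omega) :=
  <<s \bigcup_(B in [set B | finite_unions cA B /\ B `&` C = set0])
        filtration_union F B >>.

Definition adapted F X : Prop :=
  forall A, cA A -> g_sigma_algebra_preimage (X A) `<=` F A.

(* Z is a version of the conditional expectation of Y given the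
   sub-sigma-field G. *)
Definition cond_expectation (G : set (set Omega)) (Y Z : Omega -> R) : Prop :=
  [/\ g_sigma_algebra_preimage Z `<=` G,
      P.-integrable setT (EFin \o Z) &
      forall H, G H ->
        (\int[P]_(w in H) (Z w)%:E = \int[P]_(w in H) (Y w)%:E)%E].

Definition process_tuple X (s : seq (set T)) (w : Omega) :
    (size s).-tuple (borel E) :=
  map_tuple (fun U => X U w) (in_tuple s).

Definition C_Markov F X : Prop :=
  adapted F X /\
  forall (C : increment cA) (f : borel E -> R),
    measurable_fun setT f -> bounded_fun f ->
    exists Z1 Z2 : Omega -> R,
      [/\ cond_expectation (strong_history F (inc_set C))
            (fun w => f (X (inc_top C) w)) Z1,
          cond_expectation
            (g_sigma_algebra_preimage (process_tuple X (inc_enum C)))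
            (fun w => f (X (inc_top C) w)) Z2 &
          {ae P, forall w, Z1 w = Z2 w}].

End set_indexed_processes.

Definition transition_family (R : realType) (T : topologicalType)
    (E : pmetricType R) (cA : set (set T)) :=
  forall C : increment cA,
    R.-pker ((size (inc_enum C)).-tuple (borel E)) ~> (borel E).

(* Q_C is a regular version of P(X_A \in . | X_C = .), i.e. Q_C(X_C; Gamma) is
   a version of P(X_A \in Gamma | X_C) for every Borel set Gamma. *)
Definition C_transition_system (R : realType) (T : topologicalType)
    (E : pmetricType R) (d : measure_display) (Omega : measurableType d)
    (P : probability Omega R) (cA : set (set T))
    (X : set T -> Omega -> borel E) (Q : transition_family E cA) : Prop :=
  forall (C : increment cA) (Gamma : set (borel E)), measurable Gamma ->
    cond_expectation P
      (g_sigma_algebra_preimage (process_tuple X (inc_enum C)))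
      (fun w => \1_Gamma (X (inc_top C) w))
      (fun w => fine (Q C (process_tuple X (inc_enum C) w) Gamma)).

Definition initial_distribution (R : realType) (T : topologicalType)
    (E : pmetricType R) (d : measure_display) (Omega : measurableType d)
    (P : probability Omega R) (cA : set (set T))
    (X : set T -> Omega -> borel E) : set (borel E) -> \bar R :=
  pushforward P (X (initial_set cA)).

Definition fin_dim_distribution (R : realType) (T : topologicalType)
    (E : pmetricType R) (d : measure_display) (Omega : measurableType d)
    (P : probability Omega R) (X : set T -> Omega -> borel E)
    (s : seq (set T)) : set ((size s).-tuple (borel E)) -> \bar R :=
  pushforward P (process_tuple X s).

(* Main.v *)
(* The finite family of index sets is enlarged to one that is closed under
   intersections, contains the initial set, and is numbered A_0, ..., A_n so
   that no set is included in one of smaller index.  By (Shape),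
   C_i = A_i \ (A_0 u ... u A_(i-1)) is then an increment; its faces are
   intersections of the A_j, j < i, hence are themselves among them, and
   X_(A_0), ..., X_(A_(i-1)) are measurable for the strong history of C_i.  The
   C-Markov property thus gives
     P(X_(A_i) in Gamma, (X_(A_j))_(j < i) in D)
       = E[1_D((X_(A_j))_(j < i)) Q_(C_i)(X_(C_i); Gamma)],
   whose right-hand side depends on the law of (X_(A_j))_(j < i) only, and one
   concludes by induction on i and a pi-lambda argument. *)
Require Import Defs.
From mathcomp Require Import all_boot all_order all_algebra.
From mathcomp Require Import all_classical all_reals all_analysis.
From mathcomp Require Import measurable_realfun.
Import Order.TTheory GRing.Theory Num.Theory.

Local Open Scope classical_set_scope.
Local Open Scope ring_scope.

(** * Numbering a finite family of sets closed under intersection *)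

(** Maximal sets serve twice: as the set of highest index in a numbering, and as the members of an
    extremal representation. *)
Lemma maximal_mem {T : Type} (s : seq (set T)) (U : set T) : U \in s ->
  exists2 M, M \in s & U `<=` M /\ forall V, V \in s -> M `<=` V -> M = V.
Proof.
elim: s U => // A s IH U; rewrite inE => /predU1P[->{U}|/IH [M Ms [UM maxM]]].
  have [[V [Vs AV]]|maxA] := pselect (exists V, V \in s /\ A `<=` V).
    have [M Ms [VM maxM]] := IH _ Vs.
    exists M; first by rewrite inE Ms orbT.
    split=> [|W]; first exact: subset_trans AV VM.
    rewrite inE => /predU1P[-> MA|]; last exact: maxM.
    by rewrite eqEsubset; split=> //; exact: subset_trans AV VM.
  exists A; first exact: mem_head.
  split=> // V; rewrite inE => /predU1P[->//|Vs AV].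
  by case: maxA; exists V.
have [MA|MA] := pselect (M `<=` A).
  exists A; first exact: mem_head.
  split=> [|V]; first exact: subset_trans UM MA.
  rewrite inE => /predU1P[//|Vs AV].
  rewrite eqEsubset; split=> //.
  by rewrite -(maxM V Vs (subset_trans MA AV)).
exists M; first by rewrite inE Ms orbT.
by split=> // V; rewrite inE => /predU1P[->//|]; exact: maxM.
Qed.

(* The numberings A_n, ..., A_1, A_0 = I of a finite family closed under
   intersections in which no set is included in one of smaller index. *)
Inductive consistent {T : Type} (I : set T) : seq (set T) -> Prop :=
| consistent_seq1 : consistent I [:: I]
| consistent_cons (A : set T) (t : seq (set T)) : consistent I t ->
    (forall B, B \in t -> ~ A `<=` B) ->
    (forall B, B \in t -> A `&` B \in t) -> consistent I (A :: t).

Lemma consistent_mem {T : Type} (I : set T) (t : seq (set T)) :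
  consistent I t -> I \in t.
Proof. by elim=> [|A t' _ It' _ _]; rewrite inE ?eqxx// It' orbT. Qed.

Lemma consistent_setI {T : Type} (I : set T) (t : seq (set T)) :
  consistent I t -> forall U V, U \in t -> V \in t -> U `&` V \in t.
Proof.
elim=> [|A t' _ It' _ AB] U V.
  by rewrite !mem_seq1 => /eqP -> /eqP ->; rewrite setIid.
rewrite !inE => /predU1P[->|Ut] /predU1P[->|Vt].
- by rewrite setIid eqxx.
- by rewrite AB ?orbT.
- by rewrite setIC AB ?orbT.
- by rewrite It' ?orbT.
Qed.

(** Induction on the size: a maximal set [M] is taken out and receives the highest index. The rest
    stays closed under intersection, since an intersection equal to [M] would put [M] inside both
    factors and make them equal to [M]. *)
Lemma consistent_exists {T : Type} (I : set T) (s : seq (set T)) :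
  I \in s -> (forall A, A \in s -> I `<=` A) ->
  (forall A B, A \in s -> B \in s -> A `&` B \in s) ->
  exists2 t, consistent I t & s =i t.
Proof.
have [n] := ubnP (size s); elim: n s => // n IH s /ltnSE sn Is Imin sI.
have [M Ms [_ maxM]] := maximal_mem s I Is.
(* If the least set [I] is itself maximal, the family consists of [I] alone. *)
have [MI|/eqP MI] := pselect (M = I).
  exists [:: I]; first exact: consistent_seq1.
  move=> V; rewrite mem_seq1; apply/idP/eqP => [Vs|->//].
  by rewrite -MI; apply/esym/maxM => //; rewrite MI; exact: Imin.
have s'E V : (V \in [seq V <- s | V != M]) = (V != M) && (V \in s).
  by rewrite mem_filter.
have [|||A B|t ct st] := IH [seq V <- s | V != M].
- apply: leq_trans sn; rewrite size_filter -(count_predC (pred1 M) s).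
  by rewrite -[ltnLHS]add0n ltn_add2r -has_count has_pred1.
- by rewrite s'E eq_sym MI.
- by move=> A; rewrite s'E => /andP[_]; exact: Imin.
- rewrite !s'E => /andP[AM As] /andP[BM Bs]; rewrite sI// andbT.
  apply/eqP => ABM; move/eqP: AM; apply; apply/esym/maxM => //.
  by rewrite -ABM; exact: subIsetl.
exists (M :: t); last first.
  by move=> V; rewrite inE -st s'E; case: eqP => [->|].
apply: consistent_cons => // B; rewrite -st s'E => /andP[BM Bs].
  by move=> /(maxM _ Bs) /eqP; rewrite eq_sym (negbTE BM).
rewrite -st s'E sI// andbT; apply/eqP => MB; move/eqP: BM; apply.
by apply/esym/maxM => //; rewrite -MB; exact: subIsetr.
Qed.

Lemma setI_closure {T : Type} (cA : set (set T)) (I : set T) (s : seq (set T)) :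
  (forall A B, cA A -> cA B -> cA (A `&` B)) -> cA I ->
  (forall A, A \in s -> cA A) ->
  exists c : seq (set T), [/\ I \in c, {subset s <= c},
    forall A, A \in c -> cA A &
    forall A B, A \in c -> B \in c -> A `&` B \in c].
Proof.
move=> cAI cI; elim: s => [_|A s IH sA].
  exists [:: I]; split=> [|//|B|B C]; first exact: mem_head.
    by rewrite mem_seq1 => /eqP->.
  by rewrite !mem_seq1 => /eqP -> /eqP ->; rewrite setIid.
have [B Bs|c [Ic sc ccA cI']] := IH; first by apply: sA; rewrite inE Bs orbT.
have cAA : cA A by apply: sA; exact: mem_head.
(* As [c] is already stable, adjoining [A] only calls for its traces on the members of [c]. *)
exists (A :: c ++ map (setI A) c).
have inl B : B \in c -> B \in A :: c ++ map (setI A) c.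
  by move=> Bc; rewrite inE mem_cat Bc orbT.
have inr B : B \in c -> A `&` B \in A :: c ++ map (setI A) c.
  by move=> Bc; rewrite inE mem_cat map_f ?orbT.
have cases B : B \in A :: c ++ map (setI A) c ->
    [\/ B = A, B \in c | exists2 C, C \in c & B = A `&` C].
  rewrite inE mem_cat => /predU1P[->|/orP[Bc|/mapP[C Cc ->]]].
  - by apply: Or31.
  - by apply: Or32.
  - by apply: Or33; exists C.
split.
- exact: inl.
- by move=> B; rewrite inE => /predU1P[->|/sc/inl//]; exact: mem_head.
- by move=> B /cases[->//|/ccA//|[C /ccA Cc ->]]; exact: cAI.
- move=> B C /cases[->|Bc|[B' Bc ->]] /cases[->|Cc|[C' Cc ->]].
  + by rewrite setIid mem_head.
  + exact: inr.
  + by rewrite setIA setIid; exact: inr.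
  + by rewrite setIC; exact: inr.
  + exact/inl/cI'.
  + by rewrite setICA; exact/inr/cI'.
  + by rewrite setIAC setIid; exact: inr.
  + by rewrite -setIA; exact/inr/cI'.
  + by rewrite -setIIr; exact/inr/cI'.
Qed.

(** * Consequences of the indexing axioms; increments along a numbering *)

Lemma indexing_setI {T : topologicalType} (cA : set (set T)) :
  indexing_collection cA -> forall A B, cA A -> cA B -> cA (A `&` B).
Proof.
move=> idx A B cAA cB.
have <- : \bigcap_(U in [set A; B]) U = A `&` B.
  by rewrite bigcap_setU1 bigcap_set1.
by apply: (indexing_bigcap idx) => [U [->|->]//|]; exists A; left.
Qed.

Lemma initial_set_mem {T : topologicalType} (cA : set (set T)) :
  indexing_collection cA -> cA (initial_set cA).
Proof.
move=> idx; apply: (indexing_bigcap idx) => //.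
by have [B [cB _ _]] := indexing_exhaustion idx; exists (B 0%N).
Qed.

Lemma indexing_shape_seq {T : topologicalType} (cA : set (set T)) (A : set T)
    (L : seq (set T)) : indexing_collection cA -> cA A ->
  (forall U, U \in L -> cA U) -> A `<=` \bigcup_(U in [set` L]) U ->
  exists2 U, U \in L & A `<=` U.
Proof.
move=> idx cAA LA AL.
have [i|x /AL[U UL Ux]|i AU] :=
  @indexing_shape _ _ idx A (size L) (tnth (in_tuple L)) cAA.
- by apply: LA; exact: mem_tnth.
- have /tnthP[i Ui] : U \in in_tuple L by [].
  by exists i => //; rewrite -Ui.
- by exists (tnth (in_tuple L) i) => //; exact: mem_tnth.
Qed.

Lemma finite_bigcap_mem {T : Type} (t : seq (set T)) (S : set (set T)) :
  (forall U V, U \in t -> V \in t -> U `&` V \in t) ->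
  S `<=` [set` t] -> S !=set0 -> \bigcap_(V in S) V \in t.
Proof.
move=> tI St [W SW].
(* A member [W] of [S] is set aside so that the induction can start from the empty list, whose
   intersection is the whole space. *)
suff H (l : seq (set T)) : {subset l <= t} ->
    W `&` \bigcap_(V in [set` l]) V \in t.
  have [l Sl] : exists l : seq (set T), S = [set` l].
    by apply/finite_seqP; exact: (sub_finite_set St (finite_seq t)).
  have -> : \bigcap_(V in S) V = W `&` \bigcap_(V in [set` l]) V.
    rewrite -Sl eqEsubset; split=> [x Sx|x [_]//].
    by split=> //; exact: Sx.
  by apply: H => V Vl; apply: St; rewrite Sl.
elim: l => [_|A l IH Al].
  by rewrite set_nil bigcap_set0 setIT; exact: St.
rewrite bigcap_seq big_cons -bigcap_seq setICA; apply: tI.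
  exact/Al/mem_head.
by apply: IH => V Vl; apply: Al; rewrite inE Vl orbT.
Qed.

(** The increment is [A] minus the union of [t]. Its lower part must sit inside [A], so the sets of
    [t] are replaced by their traces on [A]; these remain in [t], and so do their intersections,
    hence the faces. *)
Lemma consistent_increment {T : topologicalType} (cA : set (set T))
    (I A : set T) (t : seq (set T)) :
  indexing_collection cA -> consistent I t ->
  (forall B, B \in A :: t -> cA B) ->
  (forall B, B \in t -> ~ A `<=` B) ->
  (forall B, B \in t -> A `&` B \in t) ->
  exists C : increment cA, [/\ inc_top C = A, {subset inc_enum C <= t} &
    forall B, B \in t -> B `&` inc_set C = set0].
Proof.
move=> idx ct tA AnB AB; set L := map (setI A) t.
have Lt U : U \in L -> U \in t by move=> /mapP[B Bt ->]; exact: AB.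
have LcA U : U \in L -> cA U by move=> /Lt Ut; apply: tA; rewrite inE Ut orbT.
have cAA : cA A by exact/tA/mem_head.
(* The maximal traces form the extremal representation and have the same union as all the traces. *)
pose low := [set U | U \in L /\ forall V, V \in L -> U `<=` V -> U = V].
have lowE : \bigcup_(U in low) U = \bigcup_(U in [set` L]) U.
  rewrite eqEsubset; split=> x [U]; first by move=> [UL _] Ux; exists U.
  move=> /maximal_mem[M ML [UM maxM]] Ux.
  by exists M; [split|exact: UM].
have low_fin : finite_set low.
  by apply: (sub_finite_set _ (finite_seq L)) => U [].
have low0 : low !=set0.
  have /maximal_mem[M ML [_ maxM]] : A `&` I \in L.
    by apply/map_f; exact: consistent_mem.
  by exists M.
have lowA : low `<=` cA by move=> U [/LcA].
have low_ext U V : low U -> low V -> U `<=` V -> U = V.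
  by move=> [_ maxU] [VL _]; exact: maxU.
have low_sub : \bigcup_(U in low) U `<=` A.
  by move=> x [U [/mapP[B _ ->] _] []].
(* Otherwise (Shape) would place [A] inside a single trace, hence inside a set of [t], against
   [AnB]. *)
have low_neq : A `\` \bigcup_(U in low) U !=set0.
  apply/set0P/eqP; rewrite lowE setD_eq0.
  move=> /(indexing_shape_seq _ _ _ idx cAA LcA)[_ /mapP[B Bt ->]].
  by rewrite subsetI => -[_]; exact: AnB.
exists (@Increment _ cA A low cAA low_fin low0 lowA low_ext low_sub low_neq).
have facesP U : inc_faces
    (@Increment _ cA A low cAA low_fin low0 lowA low_ext low_sub low_neq) U ->
    U \in t.
  move=> [[S [/= Slow S0 ->]] _]; apply: finite_bigcap_mem => //.
    exact: consistent_setI ct.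
  by move=> V /Slow[/Lt].
split=> //.
  move=> U; rewrite /inc_enum in_fset_set ?inE; first exact: facesP.
  by apply: (sub_finite_set _ (finite_seq t)) => V /facesP.
move=> B Bt; rewrite -subset0 => x [Bx [/= Ax]]; apply.
by rewrite /inc_union/= lowE; exists (A `&` B) => //=; exact: map_f.
Qed.

(** * Measurability of tuples, also for sub-sigma-fields *)

Lemma measurable_process_tuple {R : realType} {T : topologicalType}
    {E : pmetricType R} {d : measure_display} {Omega : measurableType d}
    (X : set T -> Omega -> borel E) (t : seq (set T)) :
  (forall A, A \in t -> measurable_fun [set: Omega] (X A)) ->
  measurable_fun [set: Omega] (process_tuple X t).
Proof.
move=> mX; apply/measurable_fun_tnthP => i.
rewrite (_ : _ \o _ = X (tnth (in_tuple t) i)); last first.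
  by apply/funext => w /=; rewrite tnth_map.
by apply: mX; exact: mem_tnth.
Qed.

(** With [G] as the sigma-field of the domain, inclusion in [G] becomes ordinary measurability, so
    that results on measurable functions apply to sub-sigma-fields. *)
Lemma g_sigma_algebra_preimageE {aT : pointedType} {d : measure_display}
    {rT : measurableType d} (G : set (set aT)) (f : aT -> rT) :
  sigma_algebra [set: aT] G ->
  g_sigma_algebra_preimage f `<=` G <->
  measurable_fun [set: g_sigma_algebraType G] f.
Proof.
move=> sG; rewrite /measurable_fun measurable_g_measurableTypeE//.
split=> [fG _ Y mY|mf _ [Y mY <-]].
  by apply: fG; exists Y.
by apply: mf => //; case: sG => G0 GC _; rewrite -(setD0 setT); exact: GC.
Qed.

Lemma process_tuple_sub_sigma {R : realType} {T : topologicalType}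
    {E : pmetricType R} {d : measure_display} {Omega : measurableType d}
    (X : set T -> Omega -> borel E) (t : seq (set T)) (G : set (set Omega)) :
  sigma_algebra [set: Omega] G ->
  (forall A, A \in t -> g_sigma_algebra_preimage (X A) `<=` G) ->
  g_sigma_algebra_preimage (process_tuple X t) `<=` G.
Proof.
move=> sG XG; apply/g_sigma_algebra_preimageE => //.
apply: (@measurable_process_tuple _ _ _ _ (g_sigma_algebraType G)) => A /XG.
by move/g_sigma_algebra_preimageE; exact.
Qed.

(** * Almost sure uniqueness of conditional expectations *)

Section conditional_expectation.
Context {R : realType} {d : measure_display} {Omega : measurableType d}.
Context (P : probability Omega R) (G : set (set Omega)).
Hypotheses (sG : sigma_algebra [set: Omega] G) (Gm : G `<=` measurable).

Lemma cond_expectation_le (Y Z1 Z2 : Omega -> R) :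
  cond_expectation P G Y Z1 -> cond_expectation P G Y Z2 ->
  {ae P, forall w, Z1 w <= Z2 w}.
Proof.
move=> [/(g_sigma_algebra_preimageE _ _ sG) mZ1 iZ1 Z1Y].
move=> [/(g_sigma_algebra_preimageE _ _ sG) mZ2 iZ2 Z2Y].
(* The exceptional event [H] belongs to [G], so it is a test event for both versions. *)
pose H := [set w | Z2 w < Z1 w].
have GH : G H.
  rewrite -(measurable_g_measurableTypeE sG).
  have := measurable_fun_ltr (T := g_sigma_algebraType G) mZ2 mZ1.
  by move=> /(_ measurableT [set true]); rewrite setTI; exact.
have mH := Gm _ GH.
have iH Z : P.-integrable setT (EFin \o Z) -> P.-integrable H (EFin \o Z).
  exact: integrableS.
(* Both versions integrate over [H] to the integral of [Y], while [Z1 - Z2] is positive there; zero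
   integral then makes [H] negligible. *)
have : (\int[P]_(w in H) `|((Z1 w)%:E - (Z2 w)%:E)| = 0)%E.
  rewrite -[RHS](subee (integrable_fin_num mH (iH _ iZ1))).
  rewrite [in X in (_ - X)%E]Z1Y//.
  rewrite -(Z2Y _ GH) -integralB_EFin; [|by []|exact: iH|exact: iH].
  apply: eq_integral => w; rewrite inE => Hw.
  by rewrite gee0_abs// sube_ge0// lee_fin ltW.
have mZ : measurable_fun H (fun w => (Z1 w)%:E - (Z2 w)%:E)%E.
  by apply: emeasurable_funB; apply: measurable_int; exact: iH.
move=> /(ae_eq_integral_abs P mH mZ).
apply: filterS => w /= Hw; rewrite leNgt; apply/negP => Zw.
move: (Hw Zw); rewrite -EFinB => -[] /eqP.
by rewrite subr_eq0 => /eqP Z12; move: Zw; rewrite Z12 ltxx.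
Qed.

Lemma cond_expectation_unique (Y Z1 Z2 : Omega -> R) :
  cond_expectation P G Y Z1 -> cond_expectation P G Y Z2 ->
  {ae P, forall w, Z1 w = Z2 w}.
Proof.
move=> cZ1 cZ2.
apply: filterS2 (cond_expectation_le _ _ _ cZ1 cZ2)
  (cond_expectation_le _ _ _ cZ2 cZ1) => w Z12 Z21.
by apply/eqP; rewrite eq_le Z12.
Qed.

End conditional_expectation.

(** * Subtuples, and laws on tuples *)

(** Sets of [u] absent from [t] receive the default [point], which makes the map total, and
    measurable without any inclusion of [u] in [t]. *)
Definition select {R : realType} {T : topologicalType} {E : pmetricType R}
    (t u : seq (set T)) (x : (size t).-tuple (borel E)) :
    (size u).-tuple (borel E) :=
  map_tuple (fun U => nth point x (index U t)) (in_tuple u).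

Lemma select_process_tuple {R : realType} {T : topologicalType}
    {E : pmetricType R} {d : measure_display} {Omega : measurableType d}
    (X : set T -> Omega -> borel E) (t u : seq (set T)) (w : Omega) :
  {subset u <= t} -> select t u (process_tuple X t w) = process_tuple X u w.
Proof.
move=> ut; apply: val_inj => /=; apply/eq_in_map => U /ut Ut.
by rewrite (nth_map U) ?index_mem// nth_index.
Qed.

Lemma measurable_select {R : realType} {T : topologicalType}
    {E : pmetricType R} (t u : seq (set T)) :
  measurable_fun [set: (size t).-tuple (borel E)] (select t u).
Proof.
apply/measurable_fun_tnthP => i; set k := index (tnth (in_tuple u) i) t.
rewrite (_ : _ \o _ = fun x : (size t).-tuple (borel E) => nth point x k).
  2: by apply/funext => x /=; rewrite tnth_map.
have [kt|tk] := ltnP k (size t).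
  rewrite (_ : (fun _ => _) = @tnth _ (borel E) ^~ (Ordinal kt)); last first.
    by apply/funext => x; rewrite (tnth_nth point).
  exact: measurable_tnth.
rewrite (_ : (fun _ => _) = cst point); first exact: measurable_cst.
by apply/funext => x; rewrite nth_default// size_tuple.
Qed.

(** The product sigma-field is generated by the rectangles head times tail, the form in which the
    Markov step delivers probabilities. *)
Lemma tuple_measurable_cons {d : measure_display} {S : measurableType d}
    {n : nat} :
  @measurable _ (n.+1.-tuple S) = <<s [set Z | exists Gamma D,
    [/\ measurable Gamma, measurable D &
        Z = [set x : n.+1.-tuple S | Gamma (thead x) /\
               D [tuple of behead x]]] ] >>.
Proof.
set G := (X in <<s X >>); rewrite eqEsubset; split=> [A mA|]; last first.
  apply: smallest_sub; first exact: sigma_algebra_measurable.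
  move=> _ [Gamma [D [mGamma mD ->]]].
  have mh := @measurable_tnth _ S n.+1 ord0 measurableT _ mGamma.
  have mb := @measurable_behead _ S n measurableT _ mD.
  by rewrite setTI in mh; rewrite setTI in mb; exact: measurableI.
(* It is enough that each coordinate be [G]-measurable: the preimage of [Y] is a rectangle whose
   head or tail side is everything. *)
suff mid : measurable_fun [set: g_sigma_algebraType G] 
    (id : _ -> n.+1.-tuple S).
  by have := mid measurableT _ mA; rewrite setTI.
apply/measurable_fun_tnthP => i _ Y mY; rewrite setTI.
apply: sub_sigma_algebra; case: (unliftP ord0 i) => [j|] ->.
  exists setT, (@tnth _ S ^~ j @^-1` Y); split=> //.
    by rewrite -[X in measurable X]setTI; exact: measurable_tnth.
  apply/seteqP; split=> x /=.
    by rewrite [in X in Y X -> _](tuple_eta x) tnthS.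
  by move=> [_]; rewrite [in X in _ -> Y X](tuple_eta x) tnthS.
exists Y, setT; split=> //.
by apply/seteqP; split=> x /=; [move=> ?; split|case].
Qed.

(** Rectangles are stable under intersection and include the whole space, so probability laws
    agreeing on them coincide. *)
Lemma eq_pushforward_cons {R : realType} {d d1 d2 : measure_display}
    {S : measurableType d} {Omega1 : measurableType d1}
    {Omega2 : measurableType d2} {n : nat} (P1 : probability Omega1 R)
    (P2 : probability Omega2 R) (f1 : Omega1 -> n.+1.-tuple S)
    (f2 : Omega2 -> n.+1.-tuple S) :
  measurable_fun setT f1 -> measurable_fun setT f2 ->
  (forall Gamma D, measurable Gamma -> measurable D ->
    P1 [set w | Gamma (thead (f1 w)) /\ D [tuple of behead (f1 w)]] =
    P2 [set w | Gamma (thead (f2 w)) /\ D [tuple of behead (f2 w)]]) ->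
  forall A, measurable A -> pushforward P1 f1 A = pushforward P2 f2 A.
Proof.
move=> mf1 mf2 P12 A mA.
apply: (measure_unique _ (fun=> setT) tuple_measurable_cons) => //.
- move=> _ _ [Gamma [D [mGamma mD ->]]] [Gamma' [D' [mGamma' mD' ->]]].
  exists (Gamma `&` Gamma'), (D `&` D'); split; [exact: measurableI..|].
  by apply/seteqP; split=> x /=; tauto.
- by move=> _; exists setT, setT; split=> //; apply/seteqP; split.
- by rewrite bigcup_const//; exists 0%N.
- by move=> _ [Gamma [D [mGamma mD ->]]]; exact: P12.
- by move=> _; rewrite /= /pushforward preimage_setT probability_setT ltry.
Qed.

Lemma eq_integral_pushforward {R : realType} {d d1 d2 : measure_display}
    {S : measurableType d} {Omega1 : measurableType d1}
    {Omega2 : measurableType d2} (m1 : {measure set Omega1 -> \bar R})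
    (m2 : {measure set Omega2 -> \bar R}) (f1 : Omega1 -> S) (f2 : Omega2 -> S)
    (D : set S) (g : S -> \bar R) :
  measurable_fun setT f1 -> measurable_fun setT f2 ->
  (forall A, measurable A -> pushforward m1 f1 A = pushforward m2 f2 A) ->
  (\int[pushforward m1 f1]_(x in D) g x =
   \int[pushforward m2 f2]_(x in D) g x)%E.
Proof.
by move=> mf1 mf2 m12; apply: eq_measure_integral => A mA _; exact: m12.
Qed.

(** * The Markov property along one increment *)

Section markov_step.
Context {R : realType} {T : topologicalType} {E : pmetricType R}.
Context {d : measure_display} {Omega : measurableType d}.
Context (P : probability Omega R) (cA : set (set T)).
Context (F : set T -> set (set Omega)) (X : set T -> Omega -> borel E).
Hypotheses (filtF : filtration P cA F) (markovX : C_Markov P cA F X).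

Lemma measurable_process (A : set T) :
  cA A -> measurable_fun [set: Omega] (X A).
Proof.
move=> cAA _ Y mY; apply: (filtration_measurable filtF cAA).
by apply: (markovX.1 _ cAA); exists Y.
Qed.

Lemma measurable_indexed_tuple (t : seq (set T)) :
  (forall B, B \in t -> cA B) -> measurable_fun setT (process_tuple X t).
Proof.
by move=> tA; apply: measurable_process_tuple => B /tA/measurable_process.
Qed.

(** Each [B] in [t] is by itself a finite union disjoint from [C], so [F B], to which [X B] is
    adapted, enters the strong history. *)
Lemma strong_history_process_tuple (C : set T) (t : seq (set T)) :
  (forall B, B \in t -> cA B) -> (forall B, B \in t -> B `&` C = set0) ->
  g_sigma_algebra_preimage (process_tuple X t) `<=` strong_history cA F C.
Proof.
move=> tA tC; apply: process_tuple_sub_sigma => [|B Bt].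
  exact: smallest_sigma_algebra.
apply: subset_trans (markovX.1 _ (tA _ Bt)) _ => H FH.
apply: sub_sigma_algebra; exists B.
  split; last exact: tC.
  exists [set B]; split; first exact: finite_set1.
  - by exists B.
  - by move=> _ ->; exact: tA.
  - by rewrite bigcup_set1.
by apply: sub_sigma_algebra; exists B => //; split=> //; exact: tA.
Qed.

Lemma markov_transition (Q : transition_family E cA) (C : increment cA)
    (t : seq (set T)) (Gamma : set (borel E))
    (D : set ((size t).-tuple (borel E))) :
  C_transition_system P X Q ->
  (forall B, B \in t -> cA B) -> {subset inc_enum C <= t} ->
  (forall B, B \in t -> B `&` inc_set C = set0) ->
  measurable Gamma -> measurable D ->
  P (X (inc_top C) @^-1` Gamma `&` process_tuple X t @^-1` D) =
  (\int[pushforward P (process_tuple X t)]_(x in D)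
     Q C (select t (inc_enum C) x) Gamma)%E.
Proof.
move=> QX tA Ct tC mGamma mD.
have mXt := measurable_indexed_tuple t tA.
set H := process_tuple X t @^-1` D.
have mH : measurable H by rewrite -[H]setTI; exact: mXt.
have mA : measurable (X (inc_top C) @^-1` Gamma).
  rewrite -[X in measurable X]setTI.
  exact: (measurable_process _ (inc_topP C)).
have GH : strong_history cA F (inc_set C) H.
  apply: (strong_history_process_tuple _ t) => //.
  by exists D => //; rewrite setTI.
have sC : g_sigma_algebra_preimage (process_tuple X (inc_enum C)) `<=`
    @measurable _ Omega.
  apply: (process_tuple_sub_sigma _ _ _ (sigma_algebra_measurable _)).
  by move=> A /Ct/tA /measurable_process mXA _ [Y mY <-]; exact: mXA.
have bGamma : bounded_fun (\1_Gamma : borel E -> R).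
  exists 1; split=> // r r1 x _ /=.
  by rewrite indicE ger0_norm// (le_trans _ (ltW r1))// lern1 leq_b1.
have mindic : measurable_fun setT (\1_Gamma : borel E -> R).
  exact: measurable_indic.
have [Z1 [Z2 [[_ iZ1 Z1E] cZ2 Z12]]] :=
  markovX.2 C _ mindic bGamma.
have cQ := QX C Gamma mGamma.
(* [H] lies in the strong history but perhaps not in the sigma-field of the faces. So only [Z1] is
   tested on [H]; [Z2] and the kernel are identified almost surely, by uniqueness. *)
have Z2Q := cond_expectation_unique P _
  (sigma_algebra_preimage _ _ (sigma_algebra_measurable _)) sC _ _ _ cZ2 cQ.
(* Finiteness undoes the [fine] in the definition of the transition system. *)
have Qfin x : Q C x Gamma \is a fin_num.
  rewrite ge0_fin_numE//; apply: le_lt_trans (ltry 1).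
  by rewrite -(@prob_kernel _ _ _ _ _ (Q C) x); apply: le_measure; rewrite ?inE.
transitivity (\int[P]_(w in H) (Z1 w)%:E)%E.
  by rewrite (Z1E _ GH) -integral_indic.
have mQ : measurable_fun setT (fun x => Q C (select t (inc_enum C) x) Gamma).
  apply: (measurableT_comp (measurable_kernel (Q C) Gamma mGamma)).
  exact: measurable_select.
rewrite (ge0_integral_pushforward mXt _ mD (measurable_funTS mQ))//.
transitivity (\int[P]_(w in H)
    (fine (Q C (process_tuple X (inc_enum C) w) Gamma))%:E)%E.
  have [_ iQ _] := cQ.
  apply: ae_eq_integral => //.
  - by apply: measurable_int; apply: integrableS iZ1.
  - by apply: measurable_int; apply: integrableS iQ.
  - by apply: filterS2 Z12 Z2Q => w -> ->.
apply: eq_integral => w _ /=.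
by rewrite select_process_tuple// fineK.
Qed.

End markov_step.

Arguments measurable_indexed_tuple {R T E d Omega P cA F X} _ _ {t}.
Arguments markov_transition {R T E d Omega P cA F X} _ _ Q {C t Gamma D}.

(** * Equality of laws along a numbering, then for arbitrary finite families *)

Lemma eq_law_consistent (R : realType) (T : topologicalType) (E : pmetricType R)
  (cA : set (set T)) (idxA : indexing_collection cA)
  (d1 d2 : measure_display)
  (Omega1 : measurableType d1) (Omega2 : measurableType d2)
  (P1 : probability Omega1 R) (P2 : probability Omega2 R)
  (F1 : set T -> set (set Omega1)) (F2 : set T -> set (set Omega2))
  (filtF1 : filtration P1 cA F1) (filtF2 : filtration P2 cA F2)
  (X1 : set T -> Omega1 -> borel E) (X2 : set T -> Omega2 -> borel E)
  (markovX1 : C_Markov P1 cA F1 X1) (markovX2 : C_Markov P2 cA F2 X2)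
  (Q : transition_family E cA)
  (X12 : forall Gamma : set (borel E), measurable Gamma ->
    initial_distribution P1 cA X1 Gamma = initial_distribution P2 cA X2 Gamma)
  (QX1 : C_transition_system P1 X1 Q) (QX2 : C_transition_system P2 X2 Q)
  (t : seq (set T)) : consistent (initial_set cA) t ->
  (forall A, A \in t -> cA A) ->
  forall D : set ((size t).-tuple (borel E)), measurable D ->
    fin_dim_distribution P1 X1 D = fin_dim_distribution P2 X2 D.
Proof.
elim=> [_ D mD|A {}t ct IH AnB AB tA].
  (* [h] sends a point to its 1-tuple; viewing it as the tuple of the identity process on [E] gives
     its measurability. *)
  pose h := @process_tuple R T E _ (borel E) (fun=> id) [:: initial_set cA].
  have mh : measurable_fun setT h by apply: measurable_process_tuple => *.
  have hE d (Omega : measurableType d) (X : set T -> Omega -> borel E) :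
      process_tuple X [:: initial_set cA] @^-1` D =
      X (initial_set cA) @^-1` (h @^-1` D).
    congr (_ @^-1` D); apply/funext => w; exact: val_inj.
  rewrite /fin_dim_distribution /pushforward (hE _ _ X1) (hE _ _ X2).
  by apply: X12; rewrite -[X in measurable X]setTI; exact: mh.
have ttA B : B \in t -> cA B by move=> Bt; apply: tA; rewrite inE Bt orbT.
have mX1 s := @measurable_indexed_tuple _ _ _ _ _ _ _ _ _ filtF1 markovX1 s.
have mX2 s := @measurable_indexed_tuple _ _ _ _ _ _ _ _ _ filtF2 markovX2 s.
have [C [CA Ct tC]] := consistent_increment _ _ _ _ idxA ct tA AnB AB.
apply: eq_pushforward_cons.
- exact: (mX1 (A :: t) tA).
- exact: (mX2 (A :: t) tA).
move=> Gamma D mGamma mD.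
have consE d (Omega : measurableType d) (X : set T -> Omega -> borel E) :
    [set w | Gamma (thead (process_tuple X (A :: t) w)) /\
             D [tuple of behead (process_tuple X (A :: t) w)]] =
    X (inc_top C) @^-1` Gamma `&` process_tuple X t @^-1` D.
  rewrite CA; have tE w : [tuple of behead (process_tuple X (A :: t) w)] =
      process_tuple X t w by exact: val_inj.
  by apply/seteqP; split=> w; rewrite /= tE (_ : thead _ = X A w).
rewrite (consE _ _ X1) (consE _ _ X2).
rewrite (markov_transition filtF1 markovX1 Q)//.
rewrite (markov_transition filtF2 markovX2 Q)//.
(* The two integrands are the same function of [Q]; only the laws of the tuples over [t] differ, and
   [IH] equates them. *)
by apply: eq_integral_pushforward; [exact: mX1|exact: mX2|exact: IH].
Qed.

Theorem theorem2p1 (R : realType) (T : metricType R) (E : pmetricType R)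
  (cA : set (set T))
  (locT : locally_compact [set: T])
  (locE : locally_compact [set: E]) (sepE : separable E)
  (idxA : indexing_collection cA)
  (d1 d2 : measure_display)
  (Omega1 : measurableType d1) (Omega2 : measurableType d2)
  (P1 : probability Omega1 R) (P2 : probability Omega2 R)
  (complP1 : measure_is_complete P1) (complP2 : measure_is_complete P2)
  (F1 : set T -> set (set Omega1)) (F2 : set T -> set (set Omega2))
  (filtF1 : filtration P1 cA F1) (filtF2 : filtration P2 cA F2)
  (X1 : set T -> Omega1 -> borel E) (X2 : set T -> Omega2 -> borel E)
  (markovX1 : C_Markov P1 cA F1 X1) (markovX2 : C_Markov P2 cA F2 X2)
  (nu : probability (borel E) R) (Q : transition_family E cA)
  (nuX1 : forall Gamma : set (borel E), measurable Gamma ->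
    initial_distribution P1 cA X1 Gamma = nu Gamma)
  (nuX2 : forall Gamma : set (borel E), measurable Gamma ->
    initial_distribution P2 cA X2 Gamma = nu Gamma)
  (QX1 : C_transition_system P1 X1 Q) (QX2 : C_transition_system P2 X2 Q) :
  forall s : seq (set T), (forall A, A \in s -> cA A) ->
  forall D : set ((size s).-tuple (borel E)), measurable D ->
    fin_dim_distribution P1 X1 D = fin_dim_distribution P2 X2 D.
Proof.
move=> s sA D mD.
have [c [Ic sc cA' cI]] := setI_closure cA (initial_set cA) s
  (indexing_setI _ idxA) (initial_set_mem _ idxA) sA.
have Imin A : A \in c -> initial_set cA `<=` A by move=> /cA' cAA x; exact.
have [t ct ctE] := consistent_exists _ _ Ic Imin cI.
have st : {subset s <= t} by move=> A /sc; rewrite ctE.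
(* The law over [s], in its given order and with possible repetitions, is the image under [select]
   of the law over the numbering [t]. *)
have selE d (Omega : measurableType d) (X : set T -> Omega -> borel E) :
    process_tuple X s @^-1` D = process_tuple X t @^-1` (select t s @^-1` D).
  by apply/seteqP; split=> w /=; rewrite select_process_tuple.
rewrite /fin_dim_distribution /pushforward (selE _ _ X1) (selE _ _ X2).
apply: (eq_law_consistent R T E cA idxA _ _ _ _ P1 P2 F1 F2 filtF1 filtF2 X1 X2
  markovX1 markovX2 Q _ QX1 QX2 t ct).
- by move=> Gamma mGamma; rewrite nuX1// nuX2.
- by move=> A; rewrite -ctE; exact: cA'.
- by rewrite -[X in measurable X]setTI; exact: measurable_select.
Qed.
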